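(* Let $\kappa$ be an uncountable cardinal with $\kappa=\kappa^{<\kappa}$. Then for every $x\in S_\kappa$ the subspace $S_\kappa\setminus\{x\}$ is not normal.
   Context: A space is zero-dimensional if it has a base of clopen sets. A subset $Y$ of a space $X$ is $C^*$-embedded if every bounded real-valued continuous function on $Y$ extends to a continuous real-valued function on $X$. In a zero-dimensional space $X$, the type $\tau(U)$ of an open set $U\subset X$ is the least cardinal $\tau$ such that $U$ is a union of $\tau$ many clopen subsets of $X$. A zero-dimensional space is an $F_\kappa$-space if its open subsets of type less than $\kappa$ are $C^*$-embedded. A $\kappa$-Parovičenko space is a compact Hausdorff zero-dimensional $F_\kappa$-space of weight $\kappa^{<\kappa}$ without isolated points such that every non-empty intersection of fewer than $\kappa$ many open sets has non-empty interior. It is known (Negrepontis) that if $\kappa=\kappa^{<\kappa}$ then there is, up to homeomorphism, exactly one $\kappa$-Parovičenko space; it is denoted $S_\kappa$. *)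

(* Defs.v *)
From HB Require Import structures.
From mathcomp Require Import all_boot all_order all_algebra.
From mathcomp Require Import all_classical all_reals all_analysis.
Import numFieldNormedType.Exports.

Set Implicit Arguments.
Unset Strict Implicit.
Unset Printing Implicit Defensive.

Local Open Scope classical_set_scope.
Local Open Scope card_scope.
Local Open Scope ring_scope.

(* A cardinal is represented by any type of that cardinality, two types being
   the same cardinal when they are equipotent.  The alias keeps all cardinals
   in a single universe, so that the suprema and minima below are taken over
   the same collection. *)
Definition cardinal := Type.

Definition card_lt (T U : Type) (A : set T) (B : set U) : Prop :=
  A #<= B /\ ~ (A #= B).

(* [weak_power K W] says that W = K^{<K}, the supremum of the cardinals K^L
   over the cardinals L < K; [L -> K] is the type of cardinality K^L. *)
Definition weak_power (K W : cardinal) : Prop :=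
  (forall L : cardinal, card_lt [set: L] [set: K] ->
     [set: L -> K] #<= [set: W]) /\
  (forall V : cardinal,
     (forall L : cardinal, card_lt [set: L] [set: K] ->
        [set: L -> K] #<= [set: V]) ->
     [set: W] #<= [set: V]).

(* Not the library's [zero_dimensional], which asks that clopen sets separate
   points. *)
Definition has_clopen_base (X : topologicalType) : Prop :=
  exists2 B : set (set X), basis B & B `<=` clopen.

Definition has_weight (X : topologicalType) (W : cardinal) : Prop :=
  (exists2 B : set (set X), basis B & B #= [set: W]) /\
  (forall B : set (set X), basis B -> [set: W] #<= B).

Definition Cstar_embedded (R : realType) (X : topologicalType) (Y : set X) :
    Prop :=
  forall f : set_type Y -> R,
    continuous f -> [bounded f y | y in [set: set_type Y]] ->
    exists2 g : X -> R, continuous g & forall y : set_type Y, g (set_val y) = f y.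

Definition clopen_union (X : topologicalType) (U : set X) (tau : cardinal) :
    Prop :=
  exists F : set (set X),
    [/\ F `<=` clopen, F #= [set: tau] & U = \bigcup_(C in F) C].

(* [has_type U tau] says that tau(U) = tau. *)
Definition has_type (X : topologicalType) (U : set X) (tau : cardinal) : Prop :=
  clopen_union U tau /\
  (forall sigma : cardinal, clopen_union U sigma -> [set: tau] #<= [set: sigma]).

Definition F_space (R : realType) (K : cardinal) (X : topologicalType) : Prop :=
  has_clopen_base X /\
  (forall (U : set X) (tau : cardinal), open U ->
     has_type U tau -> card_lt [set: tau] [set: K] -> Cstar_embedded R U).

Record parovicenko_space (R : realType) (K : cardinal) (X : topologicalType) :
    Prop := ParovicenkoSpace {
  parovicenko_compact : compact [set: X];
  parovicenko_hausdorff : hausdorff_space X;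
  parovicenko_clopen_base : has_clopen_base X;
  parovicenko_F_space : F_space R K X;
  parovicenko_weight : exists2 W : cardinal, weak_power K W & has_weight X W;
  parovicenko_no_isolated : isolated [set: X] = set0;
  parovicenko_interior : forall G : set (set X),
    G `<=` open -> card_lt G [set: K] ->
    \bigcap_(U in G) U !=set0 -> interior (\bigcap_(U in G) U) !=set0
}.

(* Main.v *)
Require Import Defs.
From mathcomp Require Import all_boot all_order all_algebra.
From mathcomp Require Import all_classical all_reals all_analysis.
From mathcomp Require Import wochoice.
Import numFieldNormedType.Exports.
Import Order.TTheory GRing.Theory Num.Theory.

Set Implicit Arguments.
Unset Strict Implicit.

Local Open Scope classical_set_scope.
Local Open Scope card_scope.
Local Open Scope ring_scope.

(* Well-order K in type kappa; kappa = kappa^{<kappa} gives kappa^omega = kappa,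
   so by Koenig's theorem kappa has uncountable cofinality.  Recursively pick
   disjoint non-empty clopen sets D_a (a < kappa) that eventually leave every
   neighbourhood of a given point other than x, while no initial part of the
   family accumulates at x, and in each D_a a strictly decreasing chain
   (E_{a,b})_{b < kappa} of clopen sets.  Away from x, the F_kappa-property
   makes Q_c = cl (U_a E_{a,c}) and P_c = cl (U_a D_a \ E_{a,c}) disjoint, so
   that cl (U_a D_a) \ {x} behaves like kappa x (kappa + 1), with D_a the a-th
   column and E_{a,c} the part above height c.  As in the classical proof that
   this product is not normal, its diagonal F and its top edge G cannot be
   separated: an open V containing G contains E_{a,g(a)} for some g, and along a
   sequence with a_{n+1} > g(a_n) the points of
   E_{a_n,a_{n+1}} \ E_{a_n,a_{n+2}} accumulate on the diagonal. *)

(** * Comparison of cardinals *)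

Lemma card_le_injP (T U : Type) (A : set T) (B : set U) :
  A #<= B <-> exists f : {x | A x} -> U,
    (forall u, B (f u)) /\ injective f.
Proof.
split=> [/card_leP [f]|[f [Bf injf]]].
  exists (fun u => set_val (f (SigSub (mem_set (svalP u))))); split.
    by move=> u; exact: set_valP.
  move=> [u Au] [v Av] /= /val_inj fuv.
  have := @inj _ _ _ f _ _ _ _ fuv.
  rewrite !inE => /(_ I I) [uv]; subst v.
  by congr exist; exact: Prop_irrelevance.
apply/card_leP/injfunPex.
exists (fun x : A =>
  SigSub (mem_set (Bf (exist A (set_val x) (set_valP x)))) : B).
  by [].
by move=> x y _ _ [/injf[/val_inj]].
Qed.

Lemma setT_card_leP (T U : Type) (B : set U) :
  [set: T] #<= B <-> exists f : T -> U, (forall x, B (f x)) /\ injective f.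
Proof.
split=> [/card_le_injP[f [Bf injf]]|[f [Bf injf]]].
  exists (fun x => f (exist _ x Logic.I)); split=> [x|x y /injf[]//].
  exact: Bf.
apply/card_le_injP; exists (fun u => f (sval u)); split=> [u|].
  exact: Bf.
by move=> [x []] [y []] /= /injf ->.
Qed.

(* Apply Zorn's lemma to the families of simultaneous choices that are injective
   in every coordinate: a maximal one exhausts some [A i], which then injects
   into all the others. *)
Lemma minimal_card (I : Type) (i0 : I) (T : Type) (A : I -> set T) :
  exists i, forall j, A i #<= A j.
Proof.
pose P := [set S : set (I -> T) | (forall s i, S s -> A i (s i)) /\
  forall s t i, S s -> S t -> s i = t i -> s = t].
have [F FP totF|S [[SA Sinj] Smax]] := @Zorn_bigcup _ P.
  split=> [s i [X FX Xs]|s t i [X FX Xs] [Y FY Yt]].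
    by have [XA _] := FP _ FX; exact: XA.
  have [XY|YX] := totF _ _ FX FY.
    by have [_ +] := FP _ FY; apply => //; exact: XY.
  by have [_ +] := FP _ FX; apply => //; exact: YX.
have [[i Ai]|noi] :=
    pselect (exists i, forall a, A i a -> exists2 s, S s & s i = a).
  exists i => j; apply/card_le_injP.
  have /choice[f fP] (u : {x | A i x}) : exists s, S s /\ s i = sval u.
    by have [s Ss <-] := Ai _ (svalP u); exists s.
  exists (fun u => f u j); split=> [u|u v fuv].
    by apply: SA; have [] := fP u.
  apply: eq_sig_hprop => [?|]; first exact: Prop_irrelevance.
  have [Su <-] := fP u; have [Sv <-] := fP v.
  by rewrite (Sinj _ _ _ Su Sv fuv).
have /choice[a aP] i : exists a, A i a /\ forall s, S s -> s i <> a.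
  apply: contrapT => H; apply: noi; exists i => a Aia; apply: contrapT => H'.
  by apply: H; exists a; split=> // s Ss sa; apply: H'; exists s.
exfalso; apply: (Smax (a |` S)).
  split; first by move=> s; right.
  by move=> /(_ a (or_introl erefl)) Sa; have [_ /(_ _ Sa)] := aP i0.
split=> [s i [->|/SA //]|s t i [->|Ss] [->|St]] //.
- by have [] := aP i.
- by have [_ /(_ _ St)] := aP i => ne /esym.
- by have [_ /(_ _ Ss)] := aP i.
- exact: Sinj.
Qed.

(** Tagging [A] and [B] in the sum type makes them a two-member family of sets over one type, so
    [minimal_card] applies. *)
Lemma card_le_total (T U : Type) (A : set T) (B : set U) : A #<= B \/ B #<= A.
Proof.
have [b Ab] := minimal_card true
  (fun b : bool => if b then (inl : T -> T + U) @` A else inr @` B).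
have cA : (inl : T -> T + U) @` A #= A by apply: inj_card_eq => ? ? _ _ [].
have cB : (inr : U -> T + U) @` B #= B by apply: inj_card_eq => ? ? _ _ [].
case: b Ab => [/(_ false)|/(_ true)].
  by rewrite (card_le_eql cA) (card_le_eqr cB); left.
by rewrite (card_le_eql cB) (card_le_eqr cA); right.
Qed.

Lemma card_ltE (T U : Type) (A : set T) (B : set U) :
  card_lt A B <-> ~ (B #<= A).
Proof.
split=> [[AB nAB] BA|nBA]; first by apply: nAB; rewrite card_eq_le AB.
have [AB|//] := card_le_total A B; split=> //.
by rewrite card_eq_le => /andP[_].
Qed.

(** * Well-orders, Koenig's theorem and transfinite recursion *)

Definition strict_well_order (T : Type) (lt : T -> T -> Prop) :=
  [/\ forall x, ~ lt x x, forall y x z, lt x y -> lt y z -> lt x z,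
      forall x y, [\/ lt x y, x = y | lt y x] & well_founded lt].

(** The order axioms are read off from least elements of sets of at most three points; antisymmetry
    comes from uniqueness of the least element of a pair. *)
Lemma exists_strict_well_order (T : Type) :
  exists lt : T -> T -> Prop, strict_well_order lt.
Proof.
have [le wole] := @well_ordering_principle {classic T}.
have minle (A : set {classic T}) : A !=set0 ->
    exists2 z, A z & forall y, A y -> le z y.
  move=> [a Aa]; have [|z [[]]] := wole (fun y => `[< A y >]).
    by exists a; apply/asboolP.
  move=> /asboolP Az zmin _; exists z => // y Ay.
  by apply: zmin; apply/asboolP.
have lexx : reflexive le.
  by move=> x; have [|z -> + //] := minle [set x]; [exists x|exact].
have le_anti : antisymmetric le .
  move=> x y /andP[xy yx];
    have [|z [_ zuniq]] := wole (fun z => `[< z = x \/ z = y >]).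
    by exists x; apply/asboolP; left.
  rewrite -(zuniq x); first apply: zuniq.
    split=> [|? /asboolP[] ->]; first by apply/asboolP; right.
      exact: yx.
    exact: lexx.
  split=> [|? /asboolP[] ->]; first by apply/asboolP; left.
    exact: lexx.
  exact: xy.
have le_tot x y : le x y \/ le y x.
  have [|z [->|->] zmin] := minle [set x; y]; first by exists x; left.
    by left; apply: zmin; right.
  by right; apply: zmin; left.
have le_trans : transitive le.
  move=> y x z xy yz; have [|w xyzw wmin] := minle [set x; y; z].
    by exists x; left; left.
  have [wx wy wz] : [/\ le w x, le w y & le w z].
    by split; apply: wmin; [left; left|left; right|right].
  case: xyzw => [[]|] /= wE; rewrite {}wE {w wmin} in wx wy wz => //.
    by rewrite (_ : x = y) //; apply: le_anti; rewrite xy wx.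
  by rewrite (_ : z = y) //; apply: le_anti; rewrite yz wy.
exists (fun x y => le x y /\ x <> y); split.
- by move=> x [].
- move=> y x z [xy nxy] [yz nyz]; split; first exact: le_trans yz.
  by move=> xz; apply: nxy; apply: le_anti; rewrite xy xz yz.
- move=> x y; have [->|xy] := pselect (x = y); first by constructor 2.
  have [le1|le1] := le_tot x y; first by constructor 1.
  by constructor 3; split => // /esym.
- move=> x; apply: contrapT => nx.
  have [|z nz zmin] := minle [set y | ~ Acc (fun x y => le x y /\ x <> y) y].
    by exists x.
  apply: nz; constructor => y [yz nyz]; apply: contrapT => /zmin zy.
  by apply: nyz; apply: le_anti; rewrite yz zy.
Qed.

(** Diagonal argument: the functions with a code in [A l] take fewer than |K| values at [l], so they
    miss one. The function [h] of missed values then has its code outside every [A l]. *)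
Lemma koenig (K L : Type) (A : L -> set K) : [set: L -> K] #<= [set: K] ->
  (forall l, ~ ([set: K] #<= A l)) -> exists k, forall l, ~ A l k.
Proof.
move=> /setT_card_leP[i [_ injI]] sA.
have /choice[h hP] l : exists v, forall f, A l (i f) -> f l <> v.
  apply: contrapT => H; apply: (sA l); apply/setT_card_leP.
  have /choice[f fP] v : exists f, A l (i f) /\ f l = v.
    apply: contrapT => H'; apply: H; exists v => f Af fv.
    by apply: H'; exists f.
  exists (i \o f); split=> [v|v w /injI fvw]; first by have [] := fP v.
  by have [_ <-] := fP v; have [_ <-] := fP w; rewrite fvw.
by exists (i h) => l /hP; exact.
Qed.

Lemma not_card_le_bigcup (K L T : Type) (A : L -> set T) :
  [set: L -> K] #<= [set: K] ->
  (forall l, ~ ([set: K] #<= A l)) -> ~ ([set: K] #<= \bigcup_l A l).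
Proof.
move=> KLK sA /setT_card_leP[f [fA injf]].
have [l|k nk] := @koenig K L (fun l => f @^-1` (A l)) KLK.
  move=> /setT_card_leP[g [gA injg]]; apply: (sA l); apply/setT_card_leP.
  by exists (f \o g); split=> // x y /injf/injg.
by have [l _ /nk] := fA k.
Qed.

(** If some initial segment is as large as [K], take the least [a] whose segment is. The order
    pulled back along an injection of [K] into the segment below [a] has only small segments. *)
Lemma initial_well_order (K : Type) : exists lt : K -> K -> Prop,
  strict_well_order lt /\ forall a, ~ ([set: K] #<= [set b | lt b a]).
Proof.
have [lt [irr tr tri wf]] := exists_strict_well_order K.
have [all_small|] :=
  pselect (forall a, ~ ([set: K] #<= [set b | lt b a])); first by exists lt.
move=> /existsNP[a0 /contrapT Ka0].
have [a [Ka amin]] : exists a, [set: K] #<= [set b | lt b a] /\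
    forall b, lt b a -> ~ ([set: K] #<= [set c | lt c b]).
  elim: (wf a0) Ka0 => {}a0 _ IH Ka0.
  have [[b [ba Kb]]|nb] :=
    pselect (exists b, lt b a0 /\ [set: K] #<= [set c | lt c b]).
    exact: IH Kb.
  by exists a0; split=> // b ba Kb; apply: nb; exists b.
have /setT_card_leP[f [fa injf]] := Ka.
exists (fun x y => lt (f x) (f y)); split; first split.
- by move=> x; exact: irr.
- by move=> y x z; exact: tr.
- by move=> x y; case: (tri (f x) (f y)) => [?|/injf ?|?];
    [constructor 1|constructor 2|constructor 3].
- move=> x; move: {2}(f x) (erefl (f x)) => y.
  elim: (wf y) x => {}y _ IH x fxy; constructor => z fzx.
  by apply: IH (erefl _); rewrite -fxy.
- move=> x Kx; apply: (amin (f x) (fa x)).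
  move: Kx => /setT_card_leP[g [gx injg]]; apply/setT_card_leP.
  by exists (f \o g); split=> // u v /injf/injg.
Qed.

(** Transfinite recursion with a choice at each stage: [P a f u] reads as [u] being admissible at
    [a] after the values of [f] below [a]. *)
Lemma wf_choice (T U : Type) (u0 : U) (lt : T -> T -> Prop)
    (P : T -> (T -> U) -> U -> Prop) :
  well_founded lt -> (forall b a c, lt a b -> lt b c -> lt a c) ->
  (forall a f g u, (forall b, lt b a -> f b = g b) -> P a f u -> P a g u) ->
  (forall a f, (forall b, lt b a -> P b f (f b)) -> exists u, P a f u) ->
  exists f, forall a, P a f (f a).
Proof.
move=> wf tr Pext Pex.
(* The default [u0] completes a partial function to a total one; it does no harm because [P a]
   depends only on values below [a]. *)
pose ext a (r : forall b, lt b a -> U) b :=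
  if pselect (lt b a) is left ba then r b ba else u0.
have /choice[s sP] (af : T * (T -> U)) : exists u,
    (forall b, lt b af.1 -> P b af.2 (af.2 b)) -> P af.1 af.2 u.
  have [/Pex[u Pu]|nP] := pselect (forall b, lt b af.1 -> P b af.2 (af.2 b)).
    by exists u.
  by exists u0.
pose step a r := s (a, ext a r).
pose f := Fix wf (fun=> U) step.
have fE a : f a = step a (fun b _ => f b).
  rewrite /f Fix_eq // => x g h gh; congr step.
  by apply: functional_extensionality_dep => y;
    apply: functional_extensionality_dep => yx; exact: gh.
have extE a b : lt b a -> ext a (fun b _ => f b) b = f b.
  by rewrite /ext; case: pselect.
exists f => a; elim: (wf a) => {}a _ IH.
apply: (Pext _ (ext a (fun b _ => f b))) => [b /extE //|].
rewrite fE; apply: (sP (a, _)) => /= b ba; rewrite extE //.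
apply: Pext (IH b ba) => c cb; rewrite extE //; exact: tr ba.
Qed.

(** * Clopen sets, types and the F_kappa-property *)

Lemma clopen_baseP (X : topologicalType) (O : set X) (p : X) :
  has_clopen_base X -> open O -> O p ->
  exists C, [/\ clopen C, C p & C `<=` O].
Proof.
move=> [B [Bo Bb] Bc] oO Op.
have [C [BC Cp] CO] := Bb p O (open_nbhs_nbhs (conj oO Op)).
by exists C; split=> //; exact: Bc.
Qed.

Lemma open_bigcup_clopen (X : topologicalType) (A : set (set X)) :
  A `<=` clopen -> open (\bigcup_(C in A) C).
Proof. by move=> Ac; apply: bigcup_open => C /Ac[]. Qed.

Lemma nbhs_set_type (X : topologicalType) (Y : set X) (O : set X) (y : Y) :
  open O -> O (set_val y) -> nbhs y (set_val @^-1` O).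
Proof.
move=> oO Oy; apply: open_nbhs_nbhs; split=> //.
by exists O.
Qed.

(** The minimum that defines the type is attained: [minimal_card] is applied to all clopen families
    with union [U], indexed by themselves. *)
Lemma has_type_card_le (X : topologicalType) (A : set (set X)) :
  A `<=` clopen -> exists2 tau : cardinal,
    has_type (\bigcup_(C in A) C) tau & [set: tau] #<= A.
Proof.
move=> Ac; set U := \bigcup_(C in A) C.
pose I := {G : set (set X) | G `<=` clopen /\ U = \bigcup_(C in G) C}.
have [i imin] := @minimal_card I (exist _ A (conj Ac erefl)) _ sval.
exists (set_type (sval i)); last first.
  rewrite (card_le_eql (card_setT _)).
  exact: (imin (exist _ A (conj Ac erefl))).
have [ic iU] := svalP i; split.
  by exists (sval i); split=> //; exact: card_setT_sym.
move=> sigma [F [Fc Fs FU]]; rewrite (card_le_eql (card_setT _)).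
by rewrite -(card_le_eqr Fs); exact: (imin (exist _ F (conj Fc FU))).
Qed.

(** The function that is 1 on the first union and 0 on the second is continuous on their union, an
    open set of type less than [K]. A continuous extension stays 1 and 0 on the two closures. *)
Lemma F_space_closureI (R : realType) (K : cardinal) (X : topologicalType)
    (A B : set (set X)) :
  F_space R K X -> A `<=` clopen -> B `<=` clopen ->
  ~ ([set: K] #<= A `|` B) ->
  \bigcup_(C in A) C `&` \bigcup_(C in B) C = set0 ->
  closure (\bigcup_(C in A) C) `&` closure (\bigcup_(C in B) C) = set0.
Proof.
move=> [_ FX] Ac Bc KAB AB0.
have ABc : A `|` B `<=` clopen by move=> C [/Ac|/Bc].
have oA := open_bigcup_clopen Ac; have oB := open_bigcup_clopen Bc.
have [tau Utau tauAB] := has_type_card_le ABc.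
set U := \bigcup_(C in _) C in Utau.
have UE : U = \bigcup_(C in A) C `|` \bigcup_(C in B) C by exact: bigcup_setU.
have Ktau : card_lt [set: tau] [set: K].
  by apply/card_ltE => /card_le_trans/(_ tauAB).
pose f (y : U) : R := if `[< (\bigcup_(C in A) C) (set_val y) >] then 1 else 0.
have fA (y : U) : (\bigcup_(C in A) C) (set_val y) -> f y = 1.
  by rewrite /f; case: asboolP.
have fB (y : U) : (\bigcup_(C in B) C) (set_val y) -> f y = 0.
  move=> yB; rewrite /f; case: asboolP => // yA.
  by have : set0 (set_val y) by rewrite -AB0.
have fc : continuous f.
  move=> y W /nbhs_singleton Wy.
  have [yA|yB] : (\bigcup_(C in A) C `|` \bigcup_(C in B) C) (set_val y).
  - by rewrite -UE; exact: set_valP.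
  - apply: filterS (nbhs_set_type oA yA) => z /= /fA fz.
    by rewrite fz -(fA _ yA).
  - apply: filterS (nbhs_set_type oB yB) => z /= /fB fz.
    by rewrite fz -(fB _ yB).
have fbd : [bounded f y | y in [set: U]].
  exists 1; split=> [|M M1 y _ /=]; first exact: num_real.
  apply: le_trans (ltW M1).
  by rewrite /f; case: asboolP; rewrite ?normr1 ?normr0 ?ler01.
have [g gc gf] := FX U tau (open_bigcup_clopen ABc) Utau Ktau f fc fbd.
have gE (D : set X) (c : R) : D `<=` U ->
    (forall y : U, D (set_val y) -> f y = c) -> closure D `<=` g @^-1` [set c].
  move=> DU fD; rewrite closureE; apply: smallest_sub.
    by apply: preimage_closed => [x _|]; [exact: gc|exact: closed_eq].
  move=> x Dx; have Ux := DU _ Dx.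
  by have := gf (SigSub (mem_set Ux)); rewrite /= => ->; rewrite fD.
apply/seteqP; split=> // x [].
have AU : \bigcup_(C in A) C `<=` U by rewrite UE => z; left.
have BU : \bigcup_(C in B) C `<=` U by rewrite UE => z; right.
move=> /(gE _ _ AU fA) /= g1 /(gE _ _ BU fB) /= g0.
by move/eqP: g1; rewrite g0 eq_sym oner_eq0.
Qed.

Lemma compact_chain_bigcap (X : topologicalType) (G : set (set X)) :
  compact [set: X] -> G !=set0 -> total_on G subset ->
  (forall A, G A -> closed A /\ A !=set0) -> \bigcap_(A in G) A !=set0.
Proof.
move=> cX [A0 GA0] totG GP.
have FF : ProperFilter (filter_from G id).
  apply: filter_from_proper => [|A /GP[]//].
  apply: filter_from_filter; first by exists A0.
  move=> A B GA GB; have [AB|BA] := totG _ _ GA GB.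
    by exists A => // y Ay; split=> //; exact: AB.
  by exists B => // y By; split=> //; exact: BA.
have [|p [_ pF]] := cX _ FF; first by exists A0.
exists p => A GA; have [cA _] := GP _ GA.
by apply: cA => W pW; apply: pF => //; exists A.
Qed.

(** * Sets smaller than kappa and sequences in kappa *)

Section small_sets.
Variables (K : cardinal).
Hypotheses (K_uncountable : ~ countable [set: K]) (KK : weak_power K K).

Lemma uncountable_not_card_le (T : Type) (A : set T) :
  countable A -> ~ ([set: K] #<= A).
Proof. by move=> cA KA; apply: K_uncountable; exact: card_le_trans KA cA. Qed.

Lemma weak_power_nat : [set: nat -> K] #<= [set: K].
Proof.
case: KK => + _; apply; apply/card_ltE.
exact: uncountable_not_card_le.
Qed.

Lemma not_card_le_setU (T : Type) (A B : set T) :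
  ~ ([set: K] #<= A) -> ~ ([set: K] #<= B) -> ~ ([set: K] #<= A `|` B).
Proof.
move=> KA KB KAB.
(* The pair is padded to a sequence, to which the bound for countable unions applies. *)
apply: (@not_card_le_bigcup K nat T (fun n => if n is 0%N then A else B)).
- exact: weak_power_nat.
- by case.
- apply: (card_le_trans KAB); apply: subset_card_le => y [Ay|By].
    by exists 0%N.
  by exists 1%N.
Qed.

Lemma not_card_le_image (T U : Type) (f : T -> U) (A : set T) :
  ~ ([set: K] #<= A) -> ~ ([set: K] #<= f @` A).
Proof.
by move=> KA KfA; apply: KA; exact: card_le_trans (card_image_le f A).
Qed.

Variable lt : K -> K -> Prop.
Hypotheses (wolt : strict_well_order lt)
  (smallseg : forall a, ~ ([set: K] #<= [set b | lt b a])).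

(** Uncountable cofinality: countably many closed initial segments, each small, do not cover [K]. *)
Lemma sequence_bounded (a : nat -> K) : exists b, forall n, lt (a n) b.
Proof.
have [_ _ tri _] := wolt.
have [n|b bP] := @koenig K nat (fun n => [set b | lt b (a n)] `|` [set a n])
    weak_power_nat.
  apply: not_card_le_setU => //; exact: uncountable_not_card_le.
exists b => n; have [//|anb|ban] := tri (a n) b; exfalso; apply: (bP n).
  by right.
by left.
Qed.

Lemma sequence_lub (a : nat -> K) : exists b, (forall n, lt (a n) b) /\
  forall c, lt c b -> exists n, lt c (a n) \/ c = a n.
Proof.
have [_ _ tri wf] := wolt.
have [b0] := sequence_bounded a.
elim: (wf b0) => {}b0 _ IH ab0.
have [[b [bb0 ab]]|nb] :=
  pselect (exists b, lt b b0 /\ forall n, lt (a n) b); first exact: IH ab.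
exists b0; split=> // c cb0; apply: contrapT => nc; apply: nb.
exists c; split=> // n; have [//|ac|ca] := tri (a n) c.
  by exfalso; apply: nc; exists n; right.
by exfalso; apply: nc; exists n; left.
Qed.

(** * Families of clopen sets in a kappa-Parovicenko space *)

Section space.
Variables (R : realType) (S : topologicalType).
Hypothesis parS : parovicenko_space R K S.

(** The intersection has non-empty interior, which is not just the point [x] because [x] is not
    isolated; a clopen set fits around any other point of it. *)
Lemma clopen_in_bigcap (G : set (set S)) (x : S) :
  G `<=` open -> ~ ([set: K] #<= G) -> \bigcap_(U in G) U !=set0 ->
  exists C, [/\ clopen C, C !=set0, C `<=` \bigcap_(U in G) U & ~ C x].
Proof.
move=> Go KG G0.
have [p pG] := parovicenko_interior parS Go ((card_ltE _ _).2 KG) G0.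
set O := interior _ in pG.
have oO : open O by exact: open_interior.
have [q [Oq qx]] : exists q, O q /\ q <> x.
  apply: contrapT => nq.
  have Ox y : O y -> y = x.
    by move=> Oy; apply: contrapT => yx; apply: nq; exists y.
  have : isolated [set: S] x.
    split; first exact/mem_set.
    exists O; first by apply: open_nbhs_nbhs; rewrite -(Ox p).
    rewrite setIT; apply/seteqP; split=> [y /Ox //|_ ->].
    by rewrite -(Ox p).
  by rewrite (parovicenko_no_isolated parS).
have oOx : open (O `&` ~` [set x]).
  apply: openI => //; apply: closed_openC; apply: accessible_closed_set1.
  exact/hausdorff_accessible/(parovicenko_hausdorff parS).
have [C [Cc Cq CO]] :=
  clopen_baseP (parovicenko_clopen_base parS) oOx (conj Oq qx).
exists C; split=> //; first by exists q.
  by move=> y /CO[/interior_subset].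
by move=> /CO[_]; apply.
Qed.

(** Recursion along the well-order; compactness gives the earlier sets a common point, so the next
    one can be chosen inside their intersection. *)
Lemma strictly_decreasing_clopens (D : set S) : clopen D -> D !=set0 ->
  exists C : K -> set S, forall b, [/\ clopen (C b), C b !=set0, C b `<=` D &
    forall c, lt c b -> C b `<=` C c /\ (C c `\` C b) !=set0].
Proof.
move=> Dc D0; have [irr tr tri wf] := wolt.
apply: (@wf_choice K (set S) set0 lt (fun b f C =>
  [/\ clopen C, C !=set0, C `<=` D &
    forall c, lt c b -> C `<=` f c /\ (f c `\` C) !=set0])) => //.
  move=> b f g C fg [? ? ? Cf]; split=> // c cb; rewrite -fg //; exact: Cf.
move=> b f IH; pose G := D |` (f @` [set c | lt c b]).
have GP A : G A -> clopen A /\ A !=set0.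
  by move=> [->//|[c cb <-]]; have [] := IH c cb.
have fD c : lt c b -> f c `<=` D by move=> cb; have [] := IH c cb.
have G0 : \bigcap_(A in G) A !=set0.
  apply: compact_chain_bigcap => [|||A /GP[[]]//].
  - exact: parovicenko_compact parS.
  - by exists D; left.
  - move=> s t [->|[c cb <-]] [->|[d db <-]].
    + by left.
    + by right; exact: fD.
    + by left; exact: fD.
    + have [cd|->|dc] := tri c d; last 2 first.
      * by left.
      * by left; have [_ _ _ /(_ _ dc)[]] := IH c cb.
      * by right; have [_ _ _ /(_ _ cd)[]] := IH d db.
(* The new set avoids a point [z] of the intersection, which makes it strictly smaller than all its
   predecessors. *)
have [z zG] := G0.
have [||C [Cc C0 CG Cz]] := clopen_in_bigcap z _ _ G0.
- by move=> A /GP[[]].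
- apply: not_card_le_setU; first exact: uncountable_not_card_le.
  exact: not_card_le_image.
exists C; split=> // [y /CG|c cb]; first by apply; left.
have Gf : G (f c) by right; exists c.
split=> [y /CG|]; first exact.
by exists z; split=> //; exact: zG.
Qed.

Lemma closureI_small (A B : set (set S)) :
  A `<=` clopen -> B `<=` clopen ->
  ~ ([set: K] #<= A) -> ~ ([set: K] #<= B) ->
  \bigcup_(C in A) C `&` \bigcup_(C in B) C = set0 ->
  closure (\bigcup_(C in A) C) `&` closure (\bigcup_(C in B) C) = set0.
Proof.
move=> Ac Bc KA KB; apply: (F_space_closureI (parovicenko_F_space parS)) => //.
exact: not_card_le_setU.
Qed.

Variable x : S.

(** The weight is at most |K|, so a base can be coded by elements of [K]. [M b] is the base set with
    code [b] if its closure misses [x], and empty otherwise. *)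
Lemma open_cover_setC1 : exists M : K -> set S,
  (forall b, open (M b) /\ ~ closure (M b) x) /\
  forall y, y <> x -> exists b, M b y.
Proof.
have [W KW [[B [Bo Bb] BW] _]] := parovicenko_weight parS.
have WK : [set: W] #<= [set: K] by case: KW => _; apply; case: KK.
have /card_le_injP[i [_ injI]] : B #<= [set: K] by rewrite (card_le_eql BW).
pose M b := \bigcup_(u in [set u | i u = b /\ ~ closure (sval u) x]) sval u.
exists M; split=> [b|y yx].
  split.
    by apply: bigcup_open => u _; exact: Bo (svalP u).
  have [[u [iu ux]]|nu] := pselect (exists u, i u = b /\ ~ closure (sval u) x).
    suff -> : M b = sval u by [].
    apply/seteqP; split=> [z [v [iv _]]|z uz]; last by exists u.
    by have -> : v = u by apply: injI; rewrite iv.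
  suff -> : M b = set0 by rewrite closure0.
  by apply/seteqP; split=> // z [v vP _]; apply: nu; exists v.
have := parovicenko_hausdorff parS; rewrite open_hausdorff => hS.
have /hS[[P Q] /= [Py Qx] [oP oQ /eqP PQ0]] : y != x by apply/eqP.
rewrite inE in Py; rewrite inE in Qx.
have [C [BC Cy] CP] := Bb y P (open_nbhs_nbhs (conj oP Py)).
exists (i (exist _ C BC)); exists (exist _ C BC) => //; split=> //= clCx.
have [z [/CP Pz Qz]] := clCx Q (open_nbhs_nbhs (conj oQ Qx)).
by have : set0 z by rewrite -PQ0; split.
Qed.

(* The family is empty when [x] is a P_K-point; otherwise it witnesses that
   [x] is not one, and the F_K-property does the rest. *)
Lemma guarding_family : exists U : set (set S),
  [/\ U `<=` [set C | clopen C /\ ~ C x], ~ ([set: K] #<= U) &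
    forall V : set (set S), V `<=` [set C | clopen C /\ ~ C x] ->
      ~ ([set: K] #<= V) -> (forall C D, U C -> V D -> C `&` D = set0) ->
      ~ closure (\bigcup_(C in V) C) x].
Proof.
have [[U [Uc KU Ux]]|nU] := pselect (exists U : set (set S),
  [/\ U `<=` [set C | clopen C /\ ~ C x], ~ ([set: K] #<= U) &
    closure (\bigcup_(C in U) C) x]).
  exists U; split=> // V Vc KV UV0 Vx.
  have : (closure (\bigcup_(C in U) C) `&`
    closure (\bigcup_(C in V) C)) x by [].
  rewrite closureI_small => // [C /Uc[]//|C /Vc[]//|].
  apply/seteqP; split=> // z [[C UC Cz] [D VD Dz]].
  by rewrite -(UV0 C D).
exists set0; split=> // [|V Vc KV _ Vx]; first exact: uncountable_not_card_le.
by apply: nU; exists V.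
Qed.

(** Recursion on [a]: fewer than |K| open sets contain [x] and exclude the guarding family, the
    earlier [M b] and the earlier [D b], and [D a] is taken in their intersection. Disjointness from
    the guarding family keeps initial parts from accumulating at [x]. *)
Lemma disjoint_clopens_to_point (M : K -> set S) :
  (forall b, open (M b) /\ ~ closure (M b) x) ->
  exists D : K -> set S, [/\
    forall a, [/\ clopen (D a), D a !=set0 & ~ D a x],
    forall a b, lt b a -> D a `&` M b = set0,
    forall a b, a <> b -> D a `&` D b = set0 &
    forall c, ~ closure (\bigcup_(a in [set a | lt a c]) D a) x].
Proof.
move=> Mo; have [irr tr tri wf] := wolt.
have [U [Uc KU UP]] := guarding_family.
have [||||D DP] := @wf_choice K (set S) set0 lt (fun a f C =>
  [/\ clopen C, C !=set0, ~ C x, forall A, U A -> A `&` C = set0 &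
    forall b, lt b a -> C `&` M b = set0 /\ C `&` f b = set0]) => //.
- move=> a f g C fg [? ? ? ? Cf]; split=> // b ba; rewrite -fg //; exact: Cf.
- move=> a f IH.
  pose G := (setC @` U) `|`
    ((fun b => ~` closure (M b) `&` ~` f b) @` [set b | lt b a]).
  have [|||C [Cc C0 CG Cx]] := @clopen_in_bigcap G x.
  + move=> _ [[A /Uc[[_ cA] _] <-]|[b /IH[[_ cfb] _ _ _ _] <-]].
      exact: closed_openC.
    by apply: openI; apply: closed_openC => //; exact: closed_closure.
  + by apply: not_card_le_setU; exact: not_card_le_image.
  + exists x => _ [[A /Uc[_ Ax] <- //]|[b /IH[_ _ fbx _ _] <-]].
    by split=> //; have [] := Mo b.
  exists C; split=> // [A UA|b ba].
    apply/seteqP; split=> // z [Az /CG] /(_ (~` A)); apply => //.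
    by left; exists A.
  have CGb z : C z -> (~` closure (M b) `&` ~` f b) z.
    by move=> /CG; apply; right; exists b.
  split; apply/seteqP; split=> // z [/CGb[Mz fz]]; last exact: fz.
  by move=> /subset_closure /Mz.
exists D; split.
- by move=> a; have [] := DP a.
- by move=> a b ba; have [_ _ _ _ /(_ b ba)[]] := DP a.
- move=> a b ab; have [ba|//|ba] := tri a b.
    by have [_ _ _ _ /(_ a ba)[_]] := DP b; rewrite setIC.
  by have [_ _ _ _ /(_ b ba)[_]] := DP a.
move=> c; have := UP (D @` [set a | lt a c]); rewrite bigcup_image; apply.
- by move=> _ [a _ <-]; have [] := DP a.
- exact: not_card_le_image.
- by move=> A _ UA [a _ <-]; have [_ _ _ /(_ _ UA)] := DP a.
Qed.

(** * The diagonal and the top edge *)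

Lemma inseparable_closed_sets : exists F G : set S,
  [/\ closed F, closed G, F `&` G `<=` [set x] &
    forall U V, open U -> open V -> F `\ x `<=` U -> G `\ x `<=` V ->
      (U `&` V) !=set0].
Proof.
have [irr tr tri wf] := wolt.
have [M [Mx Mcov]] := open_cover_setC1.
have [D [Dc DM DD Dx]] := disjoint_clopens_to_point Mx.
have /choice[E EP] a : exists E : K -> set S, forall b,
    [/\ clopen (E b), E b !=set0, E b `<=` D a &
      forall c, lt c b -> E b `<=` E c /\ (E c `\` E b) !=set0].
  by have [? ? _] := Dc a; exact: strictly_decreasing_clopens.
have Edecr a b c : lt c b -> E a b `<=` E a c.
  by move=> cb; have [_ _ _ /(_ _ cb)[]] := EP a b.
have ED a b : E a b `<=` D a by have [] := EP a b.
(* [lo] and [hi] split the columns at [c], while [P] and [Q] split the heights at [c]. *)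
pose lo c := closure (\bigcup_(a in [set a | lt a c]) D a).
pose hi c := closure (\bigcup_(a in [set a | ~ lt a c]) D a).
pose P c := closure (\bigcup_a (D a `\` E a c)).
pose Q c := closure (\bigcup_a E a c).
have succ b : exists c, lt b c.
  by have [c cP] := sequence_bounded (fun=> b); exists c; exact: cP 0%N.
(* Near a point of [M b] only the [D a] with [a] at most [b] matter. *)
have local (J : K -> set S) (X : set K) b c y : (forall a, J a `<=` D a) ->
    M b y -> lt b c -> closure (\bigcup_(a in X) J a) y ->
    closure (\bigcup_(a in X `&` [set a | lt a c]) J a) y.
  move=> JD My bc Jy W Wy; have [oM _] := Mx b.
  have [z [[a Xa Jz] [Wz Mz]]] :=
    Jy _ (filterI Wy (open_nbhs_nbhs (conj oM My))).
  exists z; split=> //; exists a => //; split=> //=.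
  have Dz := JD _ _ Jz.
  have [//|ac|ca] := tri a c.
    by have : set0 z by rewrite -(DM a b) // ac.
  by have : set0 z by rewrite -(DM a b) //; exact: tr ca.
(* Near a point other than [x] only the columns before some [d] count. These are fewer than |K|, so
   the F_kappa-property separates their lower and upper parts. *)
have PQx c : P c `&` Q c `<=` [set x].
  move=> y [Py Qy]; apply: contrapT => /Mcov[b My].
  have [d bd] := succ b.
  have {}Py := local _ _ _ _ _ (fun a z => @proj1 _ _) My bd Py.
  have {}Qy := local _ _ _ _ _ (fun a => @ED a c) My bd Qy.
  rewrite !setTI in Py Qy.
  have [A0 B0] :
      ~ ([set: K] #<= (fun a => D a `\` E a c) @` [set a | lt a d]) /\
      ~ ([set: K] #<= (fun a => E a c) @` [set a | lt a d]).
    by split; exact: not_card_le_image.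
  have H := closureI_small _ _ A0 B0; rewrite !bigcup_image in H.
  have : set0 y; last by [].
  rewrite -H //.
  - move=> _ [a _ <-]; rewrite setDE; apply: clopenI; first by have [] := Dc a.
    have [[oE cE] _ _ _] := EP a c.
    by split; [exact: closed_openC|exact: open_closedC].
  - by move=> _ [a _ <-]; have [] := EP a c.
  apply/seteqP; split=> // z [[a _ [Dz nEz]] [b' _ Ez]].
  have [ab|ab] := pselect (a = b'); first by apply: nEz; rewrite ab.
  by rewrite -(DD _ _ ab); split=> //; exact: ED Ez.
(* For each [c], the first set keeps columns before [c] below height [c] and the other columns above
   it, which describes the diagonal. The second set lies above every height: the top edge. *)
exists (\bigcap_c ((lo c `&` P c) `|` (hi c `&` Q c))), (\bigcap_c Q c).
have clc A : closed (closure A) by exact: closed_closure.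
split.
- apply: closed_bigI => c _; apply: closedU; apply: closedI; exact: clc.
- by apply: closed_bigI => c _; exact: clc.
(* With [y] in [M b] and [c] above [b], the low alternative contradicts [PQx], and the high one
   fails because [M b] meets no column from [c] on. *)
- move=> y [Fy Gy]; apply: contrapT => yx; have [b My] := Mcov _ yx.
  have [c bc] := succ b.
  have [[_ Py]|[hiy _]] := Fy c Logic.I.
    by apply: yx; apply: (PQx c); split=> //; exact: Gy.
  have [z [[a /= [nac ac] _] _]] :=
    local _ _ _ _ _ (fun a => @subset_refl _ (D a)) My bc hiy setT filterT.
  exact: nac.
move=> U V oU oV FU GV.
(* Otherwise compactness yields a point of column [a] in every [E a b] but outside [V]; it lies on
   the top edge and differs from [x], hence belongs to [V]. *)
have /choice[g gP] a : exists b, E a b `<=` V.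
  apply: contrapT => nE.
  have [|||y yE] := @compact_chain_bigcap S
    (range (fun b => E a b `\` V)) (parovicenko_compact parS).
  - by exists (E a a `\` V); exists a.
  - move=> _ _ [b _ <-] [c _ <-]; have [bc|->|cb] := tri b c.
    + by right=> y [/(Edecr _ _ _ bc)].
    + by left.
    + by left=> y [/(Edecr _ _ _ cb)].
  - move=> _ [b _ <-]; split.
      rewrite setDE; apply: closedI; last exact: open_closedC.
      by have [[]] := EP a b.
    apply: contrapT => nEV; apply: nE; exists b => y Ey.
    by apply: contrapT => nVy; apply: nEV; exists y.
  have yEb b : E a b y.
    by have [] := yE (E a b `\` V) (ex_intro2 _ _ b Logic.I erefl).
  have [_ +] := yE (E a a `\` V) (ex_intro2 _ _ a Logic.I erefl); apply.
  apply: GV; split=> [b _|yx].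
    by apply: subset_closure; exists a.
  by have [_ _ +] := Dc a; apply; rewrite -yx; exact: ED (yEb a).
(* Exceeding [a] makes the iterates increase; exceeding [g a] puts [E a (next a)] inside [V]. *)
have /choice[next nextP] a : exists b, lt a b /\ lt (g a) b.
  have [b bP] := sequence_bounded (fun n => if n is 0%N then a else g a).
  by exists b; split; [exact: bP 0%N|exact: bP 1%N].
have [|k0] := pselect (exists k : K, True); last first.
  exfalso; apply: K_uncountable.
  rewrite (_ : [set: K] = set0) //; apply/seteqP; split=> // k _.
  by apply: k0; exists k.
move=> [k0 _]; pose s n := iter n next k0.
have sS n : lt (s n) (s n.+1) by have [] := nextP (s n).
have [l [sl lub]] := sequence_lub s.
have slim c : lt c l -> exists n, forall m, (n <= m)%N -> lt c (s m).
  move=> /lub[n cn]; exists n.+1; elim=> // m IH.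
  rewrite leq_eqVlt => /predU1P[[<-]|/IH /tr]; last by apply; exact: sS.
  by case: cn => [/tr|->]; [apply; exact: sS|exact: sS].
(* [y n] lies in column [s n], between the heights [s n.+1] and [s n.+2]; columns and heights thus
   have the same limit [l]. *)
have /choice[y yP] n : exists y, E (s n) (s n.+1) y /\ ~ E (s n) (s n.+2) y.
  by have [_ _ _ /(_ _ (sS n.+1))[_ [y []]]] := EP (s n) (s n.+2); exists y.
have [p [_ py]] :=
  parovicenko_compact parS (_ : ProperFilter (y @ \oo)) filterT.
have cl (A : set S) N : (forall n, (N <= n)%N -> A (y n)) -> closure A p.
  move=> NA W Wp; have [|z [Az Wz]] := py A W _ Wp; last by exists z.
  by exists N => // n /= /NA.
have yD n : D (s n) (y n) by have [/ED] := yP n.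
(* For [c] before [l], columns and heights eventually pass [c], so the high alternative holds; for
   the other [c] all of them stay below [c], so the low one does. *)
have Fp : (\bigcap_c ((lo c `&` P c) `|` (hi c `&` Q c))) p.
  move=> c _; have [cl'|lc] := pselect (lt c l).
    have [n cn] := slim _ cl'; right; split; apply: (cl _ n) => m /cn csm.
      by exists (s m) => //= smc; apply: (irr c); exact: tr smc.
    exists (s m) => //; have [Ey _] := yP m; apply: Edecr Ey.
    exact: tr (sS m).
  have snc n : lt (s n) c.
    by have [lc'|<-|//] := tri l c; [exact: tr lc'|exact: sl].
  left; split; apply: (cl _ 0%N) => n _.
    by exists (s n) => //; exact: snc.
  exists (s n) => //; split=> // Ey; have [_] := yP n; apply.
  exact: Edecr Ey.
(* All [y n] lie in columns before [l], and these do not accumulate at [x]. *)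
have px : p <> x.
  move=> px; apply: (Dx l); rewrite -px; apply: (cl _ 0%N) => n _.
  by exists (s n) => //; exact: sl.
have Up : U p by apply: FU; split.
have Vp : closure V p.
  apply: (cl _ 0%N) => n _; have [Ey _] := yP n; apply: (gP (s n)).
  by apply: Edecr Ey; have [] := nextP (s n).
have [z [Vz Uz]] := Vp U (open_nbhs_nbhs (conj oU Up)).
by exists z.
Qed.

End space.
End small_sets.

(** * Passage to the punctured space *)

Theorem theorem5p3 (R : realType) (K : cardinal)
    (K_uncountable : ~ countable [set: K])
    (K_weak_power : weak_power K K)
    (S : topologicalType) (parS : parovicenko_space R K S) (x : S) :
  ~ normal_space (set_type (~` [set x])).
Proof.
move=> /(@normal_openP R) normal.
have [lt [wolt smallseg]] := initial_well_order K.
have [F [G [cF cG FGx FGsep]]] :=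
  inseparable_closed_sets K_uncountable K_weak_power wolt smallseg parS x.
have ox : open (~` [set x]).
  apply: closed_openC; apply: accessible_closed_set1.
  exact/hausdorff_accessible/(parovicenko_hausdorff parS).
have vc : continuous (set_val : set_type (~` [set x]) -> S).
  exact: initial_continuous.
have [|||U [V [oU oV FU GV UV0]]] :=
  normal (set_val @^-1` F) (set_val @^-1` G).
- by apply: preimage_closed => // y _; exact: vc.
- by apply: preimage_closed => // y _; exact: vc.
- by apply/seteqP; split=> // y [Fy Gy]; have := set_valP y; apply; exact: FGx.
case: oU => U' oU' U'E; case: oV => V' oV' V'E.
pose sub y (yx : (~` [set x]) y) : set_type (~` [set x]) := SigSub (mem_set yx).
(* The separating sets are traces of open sets of [S]; with [x] removed these remain open, and a
   common point of them lies in the subspace. *)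
have [||||y [[U'y yx] [V'y _]]] :=
  FGsep (U' `&` ~` [set x]) (V' `&` ~` [set x]).
- exact: openI.
- exact: openI.
- move=> y [Fy yx]; split=> //.
  have := FU (sub _ yx) Fy; by rewrite -U'E.
- move=> y [Gy yx]; split=> //.
  have := GV (sub _ yx) Gy; by rewrite -V'E.
have : (U `&` V) (sub _ yx) by rewrite -U'E -V'E.
by rewrite UV0.
Qed.
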